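(* Let $X_1\subseteq\cdots\subseteq X_L$ be nested point sets and let $b_i=A_L(\boldsymbol{e}_i^{(L)})$, $1\le i\le N_L$, be the associated multilevel cardinal functions. Then $\mathcal{B}=\{b_1,\ldots,b_{N_L}\}$ is a basis of $\widetilde V_L=A_L(C(\Omega))$; in particular $\dim\widetilde V_L=N_L$. Moreover, the basis functions are cardinal in the sense that $b_i(\boldsymbol{x}_j)=\delta_{ij}$ for $1\le i,j\le N_L$.
   Context: Let $\Omega\subseteq\mathbb{R}^d$ be a bounded domain and $X_1\subseteq X_2\subseteq\cdots\subseteq X_L\subseteq\Omega$ nested finite point sets, ordered so that $X_\ell=\{\boldsymbol{x}_1,\ldots,\boldsymbol{x}_{N_\ell}\}$ (distinct points) for $1\le\ell\le L$. Their fill distances $h_\ell=\sup_{\boldsymbol{x}\in\Omega}\min_{1\le i\le N_\ell}\|\boldsymbol{x}-\boldsymbol{x}_i\|_2$ satisfy $c\mu h_\ell\le h_{\ell+1}\le\mu h_\ell$ with fixed $\mu\in(0,1)$, $c\in(0,1]$. Let $\Phi:\mathbb{R}^d\to\mathbb{R}$ be a positive definite radial basis function (continuous, with all matrices $(\Phi(\boldsymbol{y}_i-\boldsymbol{y}_j))_{i,j}$ for distinct points positive definite) with support in the closed unit ball, and let $\Phi_\ell=\delta_\ell^{-d}\Phi(\cdot/\delta_\ell)$ with $\delta_\ell=\nu h_\ell$ and a fixed $\nu>1$. Let $W_\ell=\operatorname{span}\{\Phi_\ell(\cdot-\boldsymbol{x}_i):1\le i\le N_\ell\}$. For $g\in C(\Omega)$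 let $I_{X_\ell,\Phi_\ell}(g)\in W_\ell$ be the unique element of $W_\ell$ that coincides with $g$ on $X_\ell$. For $f\in C(\Omega)$ put $e_0=f$ and, for $\ell\ge1$, $s_\ell=I_{X_\ell,\Phi_\ell}(e_{\ell-1})$, $e_\ell=e_{\ell-1}-s_\ell$; the multilevel operator is $A_L(f)=\sum_{\ell=1}^L s_\ell$, and $\widetilde V_L:=A_L(C(\Omega))$. Since the sets are nested, $A_L(f)$ depends only on the vector of values $f|_{X_L}\in\mathbb{R}^{N_L}$, so $A_L$ is also regarded as a map on $\mathbb{R}^{N_L}$: for $\boldsymbol{y}\in\mathbb{R}^{N_L}$, $A_L(\boldsymbol{y}):=A_L(f)$ for any $f\in C(\Omega)$ with $f|_{X_L}=\boldsymbol{y}$. $\boldsymbol{e}_i^{(L)}$ is the $i$-th unit vector of $\mathbb{R}^{N_L}$. *)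

(* Defs.v *)
From HB Require Import structures.
From mathcomp Require Import all_boot all_order all_algebra.
From mathcomp Require Import all_classical all_reals all_analysis.
Set Implicit Arguments.
Unset Strict Implicit.
Unset Printing Implicit Defensive.
Import Order.TTheory GRing.Theory Num.Theory.
Import numFieldNormedType.Exports.
Local Open Scope classical_set_scope.
Local Open Scope ring_scope.

(** Bases of subsets of a (possibly infinite-dimensional) vector space. *)

Section LinearAlgebra.
Variables (K : fieldType) (V : lmodType K).

Definition linear_span n (b : 'I_n -> V) : set V :=
  [set v | exists c : 'I_n -> K, v = \sum_(i < n) c i *: b i].

Definition linearly_independent n (b : 'I_n -> V) : Prop :=
  forall c : 'I_n -> K, \sum_(i < n) c i *: b i = 0 -> forall i, c i = 0.

(* Since a span is a linear subspace, the second clause also says that [S] is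
   one. *)
Definition is_basis (S : set V) n (b : 'I_n -> V) : Prop :=
  linearly_independent b /\ S = linear_span b.

Definition has_dimension (S : set V) (n : nat) : Prop :=
  (exists b : 'I_n -> V, is_basis S b) /\
  (forall m (b : 'I_m -> V), is_basis S b -> m = n).

End LinearAlgebra.

Section Multilevel.
Variables (R : realType) (d : nat).
Local Notation E := 'rV[R]_d.
Local Notation F := (E -> R^o).

(* The library norm on ['rV[R]_d] is the maximum norm; it induces the same
   topology and bounded sets, but distances here are Euclidean. *)
Definition norm2 (y : E) : R := Num.sqrt (\sum_(k < d) y 0 k ^+ 2).

Definition bounded_domain (Omega : set E) : Prop :=
  [/\ open Omega, connected Omega, Omega !=set0 & bounded_set Omega].

Definition posdef_matrix n (M : 'M[R]_n) : Prop :=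
  M^T = M /\ forall v : 'rV[R]_n, v != 0 -> 0 < (v *m M *m v^T) 0 0.

Definition posdef_rbf (Phi : F) : Prop :=
  [/\ exists phi : R -> R, forall y, Phi y = phi (norm2 y),
      continuous Phi
    & forall n (y : 'I_n -> E), injective y ->
        posdef_matrix (\matrix_(i < n, j < n) Phi (y i - y j))].

Definition supported_in_unit_ball (Phi : F) : Prop :=
  closure [set y | Phi y != 0] `<=` [set y | norm2 y <= 1].

Definition rescale (Phi : F) (delta : R) : F :=
  fun y => delta ^- d * Phi (delta^-1 *: y).

(* Points are enumerated from 0 as [x 0, x 1, ...]; the set of the first [n]
   points is [x @` `I_n].  For [0 < n] the infimum below is a minimum. *)
Definition fill_distance (Omega : set E) (x : nat -> E) (n : nat) : R :=
  sup [set inf [set norm2 (z - x i) | i in `I_n] | z in Omega].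

Definition translates (K : F) (x : nat -> E) n : 'I_n -> F :=
  fun i y => K (y - x i).

Definition interpolant (K : F) (x : nat -> E) (n : nat) (g : F) : F :=
  xget 0 [set s | linear_span (translates K x (n := n)) s /\
                  forall i : 'I_n, s (x i) = g (x i)].

Section Operator.
(* [K l] is the kernel and [N l] the number of points on level [l >= 1]; the
   values at [l = 0] are not used. *)
Variables (K : nat -> F) (x : nat -> E) (N : nat -> nat).

Fixpoint residual (l : nat) (f : F) : F :=
  if l is l'.+1
  then residual l' f - interpolant (K l) x (N l) (residual l' f)
  else f.

Definition multilevel (L : nat) (f : F) : F :=
  \sum_(1 <= l < L.+1) interpolant (K l) x (N l) (residual l.-1 f).

(* A function on [Omega] is represented by a function on the whole space, of
   which only the values on [Omega] matter: continuity is required within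
   [Omega] only, and [multilevel] evaluates [f] at the points [x i] only. *)
Definition continuous_on (Omega : set E) : set F :=
  [set f | {within Omega, continuous f}].

Definition multilevel_space (Omega : set E) (L : nat) : set F :=
  multilevel L @` continuous_on Omega.

(* The common value of [multilevel L f] over all continuous [f] with the
   prescribed values [y] at the points. *)
Definition multilevel_of_values (Omega : set E) (L : nat)
    (y : 'rV[R]_(N L)) : F :=
  xget 0 (multilevel L @`
    [set f | continuous_on Omega f /\ forall i : 'I_(N L), f (x i) = y 0 i]).

Definition multilevel_cardinal (Omega : set E) (L : nat) (i : 'I_(N L)) : F :=
  multilevel_of_values Omega (delta_mx 0 i).

End Operator.

End Multilevel.

(* Main.v *)
Require Import Defs.
From HB Require Import structures.
From mathcomp Require Import all_boot all_order all_algebra.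
From mathcomp Require Import all_classical all_reals all_analysis.
Set Implicit Arguments.
Unset Strict Implicit.
Unset Printing Implicit Defensive.
Import Order.TTheory GRing.Theory Num.Theory.
Import numFieldNormedType.Exports.
Local Open Scope classical_set_scope.
Local Open Scope ring_scope.

(** The multilevel operator telescopes: [A_L f = f - e_L], where [e_L] is the
    last residual ([multilevelE]).  Everything follows from three properties of
    residuals, all inherited from one-level interpolation.

    - Residuals are linear in [f], hence so is [A_L].
    - The last correction interpolates [e_(L-1)] on the finest set [X_L], so
      [e_L] vanishes there and [A_L f] agrees with [f] on [X_L]
      ([nodal_multilevel]).
    - If [f] vanishes on [X_L], then by nestedness it vanishes on every coarser
      set, every correction is zero and [A_L f = 0]; hence [A_L f] depends only
      on the values of [f] on [X_L] ([multilevel_ext]).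

    A continuous [f_i] with value 1 at [x_i] and 0 at the other points exists,
    namely a combination of translates of the finest kernel, and
    [b_i = A_L f_i].  The second property gives [b_i (x_j) = delta_ij], which
    forces linear independence; the other two give
    [A_L f = sum_i f(x_i) b_i], so the [b_i] span the range.

    One-level interpolation is well posed when the collocation matrix is
    invertible.  For the rescaled kernels this is positive definiteness of the
    radial basis function at the dilated points, provided that the scale is
    nonzero.  This is where the domain enters: finitely many points cannot
    exhaust a nonempty open set, and boundedness makes the supremum defining
    the fill distance a genuine one, so the fill distance is positive
    ([fill_distance_gt0]). *)

(** * Bases of subsets of a vector space *)

Section LinearAlgebra.
Variables (K : fieldType) (V : lmodType K).

Lemma linear_sum_scale (W : lmodType K) (f : V -> W) (f_linear : linear f)
    n (c : 'I_n -> K) (v : 'I_n -> V) :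
  f (\sum_(i < n) c i *: v i) = \sum_(i < n) c i *: f (v i).
Proof.
pose fL : {linear V -> W} := HB.pack f (GRing.isLinear.Build _ _ _ _ f f_linear).
rewrite -[f]/(fL : V -> W) linear_sum; apply: eq_bigr => i _.
by rewrite linearZ.
Qed.

Lemma basis_mem (S : set V) n (b : 'I_n -> V) i : is_basis S b -> S (b i).
Proof.
move=> [_ ->]; exists (fun j => (j == i)%:R).
rewrite (bigD1 i) //= eqxx scale1r big1 ?addr0 // => j /negPf ->.
by rewrite scale0r.
Qed.

(** Expanding each basis in the other gives matrices [A] and [B] with
    [A *m B = 1], which bounds the number of rows of [A] by its number of
    columns. *)
Lemma basis_size_le (S : set V) m n (b : 'I_m -> V) (b' : 'I_n -> V) :
  is_basis S b -> is_basis S b' -> (m <= n)%N.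
Proof.
move=> hb hb'.
have /choice[A hA] i : exists a : 'I_n -> K, b i = \sum_(j < n) a j *: b' j.
  by have := basis_mem i hb; rewrite hb'.2.
have /choice[B hB] j : exists a : 'I_m -> K, b' j = \sum_(i < m) a i *: b i.
  by have := basis_mem j hb'; rewrite hb.2.
apply: (@mulmx1_min K m n (\matrix_(i, j) A i j) (\matrix_(j, i) B j i)).
apply/matrixP => i k; rewrite !mxE; apply/eqP; rewrite -subr_eq0; apply/eqP.
(* The entries of [A *m B - 1] in row [i] are the coefficients of a vanishing
   combination of the [b k]. *)
apply: (hb.1 (fun k => (\sum_j (\matrix_(i, j) A i j) i j *
  (\matrix_(j, i) B j i) j k) - (i == k)%:R)).
under eq_bigr => l _ do rewrite scalerBl scaler_suml.
rewrite sumrB exchange_big /=.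
rewrite (bigD1 (P := predT) i) //= [X in _ - (_ + X)]big1 => [|l]; last first.
  by rewrite eq_sym => /negPf ->; rewrite scale0r.
rewrite eqxx scale1r addr0 hA; apply/eqP; rewrite subr_eq0; apply/eqP.
apply: eq_bigr => j _; rewrite hB scaler_sumr.
by apply: eq_bigr => l _; rewrite !mxE scalerA.
Qed.

Lemma basis_dimension (S : set V) n (b : 'I_n -> V) :
  is_basis S b -> has_dimension S n.
Proof.
move=> hb; split; first by exists b.
move=> m b' hb'; apply/eqP.
by rewrite eqn_leq (basis_size_le hb' hb) (basis_size_le hb hb').
Qed.

End LinearAlgebra.

(** * Interpolation on one level *)

Section Interpolation.
Variables (R : realType) (d : nat).
Local Notation E := 'rV[R]_d.
Local Notation F := (E -> R^o).

Lemma combinationE n (c : 'I_n -> R) (b : 'I_n -> F) y :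
  (\sum_(i < n) c i *: b i) y = \sum_(i < n) c i * b i y.
Proof. by rewrite fct_sumE. Qed.

Section OneLevel.
Variables (K : F) (x : nat -> E) (n : nat).

Definition nodal_values (g : F) : 'rV[R]_n := \row_j g (x j).

(** The index of the translate is the row, so that the nodal values of a
    combination of translates are a row vector times this matrix. *)
Definition collocation : 'M[R]_n := \matrix_(i, j) translates K x i (x j).

Definition kernel_combination (c : 'rV[R]_n) : F :=
  \sum_(i < n) c 0 i *: translates K x i.

Lemma nodal_values_linear : linear nodal_values.
Proof. by move=> a f g; apply/rowP => j; rewrite !mxE. Qed.

Lemma kernel_combination_linear : linear kernel_combination.
Proof.
move=> a u v; rewrite /kernel_combination scaler_sumr -big_split /=.
by apply: eq_bigr => i _; rewrite !mxE scalerDl scalerA.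
Qed.

Lemma nodal_kernel_combination c :
  nodal_values (kernel_combination c) = c *m collocation.
Proof.
apply/rowP => j; rewrite !mxE [LHS]combinationE.
by apply: eq_bigr => i _; rewrite !mxE.
Qed.

Hypothesis unisolvent : collocation \in unitmx.

(** Solving the collocation system gives one interpolant, and invertibility
    makes it the only one, so the choice made by [interpolant] is forced. *)
Lemma interpolantE g :
  interpolant K x n g = kernel_combination (nodal_values g *m invmx collocation).
Proof.
apply: xget_unique.
  split; first by exists (fun i => (nodal_values g *m invmx collocation) 0 i).
  move=> i; have := nodal_kernel_combination (nodal_values g *m invmx collocation).
  by rewrite mulmxKV // => /rowP/(_ i); rewrite !mxE.
move=> s [[c ->] hs].
have -> : \sum_(i < n) c i *: translates K x i = kernel_combination (\row_i c i).
  by apply: eq_bigr => i _; rewrite mxE.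
congr kernel_combination.
rewrite -[LHS](mulmxK unisolvent) -nodal_kernel_combination; congr (_ *m _).
apply/rowP => j; rewrite !mxE -hs; congr (_ _).
by apply: eq_bigr => i _; rewrite mxE.
Qed.

Lemma nodal_interpolant g : nodal_values (interpolant K x n g) = nodal_values g.
Proof. by rewrite interpolantE nodal_kernel_combination mulmxKV. Qed.

Lemma interpolant_linear : linear (interpolant K x n).
Proof.
move=> a f g; rewrite !interpolantE nodal_values_linear mulmxDl -scalemxAl.
exact: kernel_combination_linear.
Qed.

Lemma interpolant0 g : nodal_values g = 0 -> interpolant K x n g = 0.
Proof.
move=> g0; rewrite interpolantE g0 mul0mx /kernel_combination big1 // => i _.
by rewrite mxE scale0r.
Qed.

Lemma kernel_combination_continuous c :
  continuous K -> continuous (kernel_combination c).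
Proof.
move=> Kcont y; rewrite /kernel_combination.
elim/big_ind: _ => [|f g fc gc|i _]; first exact: cst_continuous.
  exact: continuousD.
apply: continuousM; first exact: cst_continuous.
have shift_cont : {for y, continuous (fun z : E => z - x i)}.
  by apply: continuousB; [exact: cvg_id|exact: cst_continuous].
exact: continuous_comp shift_cont (Kcont _).
Qed.

(** The interpolant itself is the continuous extension, since the kernel is
    continuous on the whole space. *)
Lemma exists_continuous_nodal (v : 'rV[R]_n) : continuous K ->
  exists2 f : F, continuous f & nodal_values f = v.
Proof.
move=> Kcont; exists (kernel_combination (v *m invmx collocation)).
  exact: kernel_combination_continuous.
by rewrite nodal_kernel_combination mulmxKV.
Qed.

End OneLevel.

(** * The multilevel operator *)

Section Levels.
Variables (K : nat -> F) (x : nat -> E) (N : nat -> nat) (L : nat).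
Hypothesis unisolvent :
  forall l, (1 <= l <= L)%N -> collocation (K l) x (N l) \in unitmx.

(** Each correction is the difference of two consecutive residuals, so their
    sum telescopes. *)
Lemma multilevelE f : multilevel K x N L f = f - residual K x N L f.
Proof.
rewrite /multilevel big_add1 /= (eq_bigr (fun l =>
  - (residual K x N l.+1 f - residual K x N l f))).
  by rewrite sumrN telescope_sumr //= opprB.
by move=> l _ /=; rewrite opprB subKr.
Qed.

Lemma residual_linear l : (l <= L)%N -> linear (residual K x N l).
Proof.
elim: l => [|l IH] lL a f g //=.
rewrite (IH (ltnW lL)) interpolant_linear ?unisolvent //.
by rewrite scalerBr opprD addrACA.
Qed.

Lemma multilevel_linear : linear (multilevel K x N L).
Proof.
move=> a f g; rewrite !multilevelE residual_linear //.
by rewrite scalerBr opprD addrACA.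
Qed.

(** The last step subtracts from [e_(L-1)] its own interpolant on the finest
    set. *)
Lemma nodal_residual f : (1 <= L)%N ->
  nodal_values x (N L) (residual K x N L f) = 0.
Proof.
move=> L1; have := unisolvent (l := L); rewrite L1 leqnn => /(_ isT).
case: L L1 => // l _ U; apply/rowP => j; rewrite !mxE /=.
have /rowP/(_ j) := nodal_interpolant U (residual K x N l f).
by rewrite !mxE => h; apply/eqP; rewrite [X in X == _]/= subr_eq0 -h.
Qed.

Lemma nodal_multilevel f : (1 <= L)%N ->
  nodal_values x (N L) (multilevel K x N L f) = nodal_values x (N L) f.
Proof.
move=> L1; have /rowP h := nodal_residual f L1.
apply/rowP => j; have := h j; rewrite multilevelE !mxE => hj.
by rewrite -[RHS]subr0 -hj.
Qed.

Hypothesis nested : forall l, (1 <= l <= L)%N -> (N l <= N L)%N.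

(** By nestedness a function that vanishes on the finest set has zero data on
    each level, so no level corrects it. *)
Lemma residual_id l f : (l <= L)%N -> nodal_values x (N L) f = 0 ->
  residual K x N l f = f.
Proof.
move=> + f0; elim: l => [//|l IH] lL /=; rewrite IH ?(ltnW lL) //.
rewrite interpolant0 ?subr0 ?unisolvent //.
apply/rowP => j.
have /rowP/(_ (widen_ord (nested (l := l.+1) lL) j)) := f0.
by rewrite !mxE.
Qed.

(** Apply [residual_id] to [f - g]. *)
Lemma multilevel_ext f g : nodal_values x (N L) f = nodal_values x (N L) g ->
  multilevel K x N L f = multilevel K x N L g.
Proof.
move=> fg; apply/eqP; rewrite -subr_eq0; apply/eqP.
have := multilevel_linear (-1) g f; rewrite !scaleN1r addrC => <-.
rewrite multilevelE residual_id ?subrr //.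
by have := nodal_values_linear x (N L) (-1) g f; rewrite fg !scaleN1r addNr.
Qed.

Hypotheses (L1 : (1 <= L)%N) (Kcont : continuous (K L)).
Variable Omega : set E.

(** The choice hidden in [multilevel_of_values] is made from a nonempty set,
    since continuous functions with prescribed nodal values exist. *)
Lemma multilevel_of_valuesE v : exists f : F,
  [/\ continuous_on Omega f, nodal_values x (N L) f = v
    & multilevel_of_values K x Omega v = multilevel K x N L f].
Proof.
have LL : (1 <= L <= L)%N by rewrite L1 leqnn.
have [f fc fv] := exists_continuous_nodal (unisolvent LL) v Kcont.
have := @xgetPex _ (0 : F) (multilevel K x N L @`
  [set f | continuous_on Omega f /\ forall i : 'I_(N L), f (x i) = v 0 i]).
rewrite -/(multilevel_of_values K x Omega v) => -[|g [gc gv] <-].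
  exists (multilevel K x N L f); exists f => //; split.
    exact: continuous_subspaceT.
  by move=> i; rewrite -fv mxE.
by exists g; split=> //; apply/rowP => i; rewrite mxE.
Qed.

Local Notation b := (multilevel_cardinal (N := N) K x Omega (L := L)).

Lemma multilevel_cardinalP (i j : 'I_(N L)) : b i (x j) = (i == j)%:R.
Proof.
have [f [_ fv bE]] := multilevel_of_valuesE (delta_mx 0 i).
have /rowP/(_ j) := nodal_multilevel f L1.
by rewrite fv /multilevel_cardinal bE !mxE eqxx /= eq_sym.
Qed.

(** Evaluation at the nodes recovers the coefficients of a combination of the
    cardinal functions.  For the span, [g] and the sum of the [g (x i) *: f i]
    have the same nodal values when each [f i] has the nodal values of a unit
    vector, so [multilevel] does not distinguish them. *)
Lemma multilevel_cardinal_basis :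
  is_basis (multilevel_space K x N Omega L) b.
Proof.
split=> [c c0 i|].
  have := congr1 (fun f : F => f (x i)) c0; rewrite combinationE.
  rewrite (bigD1 i) //= multilevel_cardinalP eqxx mulr1 big1 ?addr0 //.
  by move=> j /negPf ji; rewrite multilevel_cardinalP ji mulr0.
have /choice[f hf] := fun i : 'I_(N L) => multilevel_of_valuesE (delta_mx 0 i).
have sumE c : multilevel K x N L (\sum_i c i *: f i) = \sum_i c i *: b i.
  rewrite (linear_sum_scale multilevel_linear).
  by apply: eq_bigr => i _; have [_ _ <-] := hf i.
apply/seteqP; split=> s.
  move=> [g gc <-]; exists (fun i => g (x i)); rewrite -sumE.
  apply: multilevel_ext; rewrite (linear_sum_scale (nodal_values_linear x (N L))).
  rewrite [LHS]row_sum_delta; apply: eq_bigr => i _; have [_ -> _] := hf i.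
  by rewrite mxE.
move=> [c ->]; rewrite -sumE; exists (\sum_i c i *: f i) => //.
rewrite /continuous_on /= => y; elim/big_ind: _ => [|u v uc vc|i _].
- exact: cst_continuous.
- exact: continuousD.
- apply: continuousM; first exact: cst_continuous.
  by have [h _ _] := hf i; exact: h.
Qed.

End Levels.
End Interpolation.

(** * Unisolvence of the rescaled kernels *)

Section Kernels.
Variables (R : realType) (d : nat).
Local Notation E := 'rV[R]_d.
Local Notation F := (E -> R^o).

Lemma posdef_unit n (M : 'M[R]_n) : posdef_matrix M -> M \in unitmx.
Proof.
move=> [_ Mpos]; rewrite -row_free_unit; apply: inj_row_free => v vM.
apply/eqP; apply: contraT => /Mpos.
by rewrite vM mul0mx mxE ltxx.
Qed.

Lemma rescale_continuous (Phi : F) delta :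
  continuous Phi -> continuous (rescale Phi delta).
Proof.
move=> Pc y; rewrite /rescale.
apply: (@continuousM _ _ (fun=> delta ^- d)); first exact: cst_continuous.
have dil_cont : {for y, continuous (fun z : E => delta^-1 *: z)}.
  exact: scaler_continuous.
exact: continuous_comp dil_cont (Pc _).
Qed.

(** Up to the nonzero factor [delta ^- d], this is the transposed matrix of the
    unscaled kernel at the points [x i / delta], which stay distinct. *)
Lemma collocation_rescale_unit (Phi : F) delta (x : nat -> E) n :
    posdef_rbf Phi -> delta != 0 ->
    (forall i j, (i < n)%N -> (j < n)%N -> x i = x j -> i = j) ->
  collocation (rescale Phi delta) x n \in unitmx.
Proof.
move=> [_ _ Ppos] delta0 xinj.
have yinj : injective (fun i : 'I_n => delta^-1 *: x i).
  move=> i j /(scalerI (invr_neq0 delta0)) /xinj h.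
  exact/val_inj/h.
have -> : collocation (rescale Phi delta) x n =
    delta ^- d *: (\matrix_(i < n, j < n) Phi (delta^-1 *: x i - delta^-1 *: x j))^T.
  by apply/matrixP => i j; rewrite !mxE /translates /rescale scalerBr.
rewrite unitmxZ ?unitmx_tr; first exact/posdef_unit/Ppos.
by rewrite unitfE invr_neq0 // expf_neq0.
Qed.

End Kernels.

(** * Positivity of the fill distance *)

Section FillDistance.
Variables (R : realType) (d : nat).
Local Notation E := 'rV[R]_d.

Lemma norm2_gt0 (y : E) : y != 0 -> 0 < norm2 y.
Proof.
move=> y0; rewrite sqrtr_gt0 lt_neqAle sumr_ge0 ?andbT; last first.
  by move=> k _; exact: sqr_ge0.
apply: contraNneq y0 => /esym/eqP; rewrite psumr_eq0 => [/allP h|k _]; last first.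
  exact: sqr_ge0.
apply/eqP/rowP => k; rewrite mxE; apply/eqP.
by have := h k (mem_index_enum _); rewrite /= sqrf_eq0.
Qed.

Lemma norm2_le_mx_norm (y : E) : norm2 y <= Num.sqrt (`|y| ^+ 2 *+ d).
Proof.
apply: ler_wsqrtr; rewrite -[X in _ *+ X]card_ord -sumr_const.
apply: ler_sum => k _; rewrite -[leLHS]real_normK ?num_real //.
rewrite ler_pXn2r ?nnegrE //.
by rewrite [leRHS]/Num.norm /= mx_normrE; apply/bigmax_geP; right; exists (0, k).
Qed.

(** A ball inside [Omega] contains infinitely many points on a segment, here
    [z0 + e / (k + 2) * (1, ..., 1)], so finitely many points cannot cover it.
    In dimension 0 this fails, as the space is a single point. *)
Lemma open_not_covered (Omega : set E) (x : nat -> E) n : (0 < d)%N ->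
  open Omega -> Omega !=set0 ->
  exists2 z, Omega z & forall i, (i < n)%N -> z != x i.
Proof.
move=> d0 oO [z0 Oz0].
have /nbhs_ballP[e /= e0 ballO] : nbhs z0 Omega by exact: open_nbhs_nbhs.
pose t (k : nat) : R := e / k.+2%:R.
pose z (k : nat) : E := z0 + const_mx (t k).
have Oz k : Omega (z k).
  apply: ballO; rewrite mx_norm_ball /ball_ /= opprD addrA subrr sub0r normrN.
  rewrite [ltLHS]/Num.norm /= mx_normrE; apply/bigmax_ltP; split=> // i _.
  by rewrite mxE gtr0_norm ?divr_gt0 // ltr_pdivrMr // ltr_pMr // ltr1n.
apply: contrapT => none.
have covered : forall k, (x @` `I_n) (z k).
  move=> k; apply: contrapT => nk; apply: none; exists (z k) => // i ilt.
  by apply/eqP => zi; apply: nk; exists i.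
have zinj : injective z.
  move=> k l /addrI /rowP /(_ (Ordinal d0)); rewrite !mxE.
  move=> /(mulfI (lt0r_neq0 e0)) /invr_inj /eqP.
  by rewrite eqr_nat => /eqP [].
apply: infinite_nat.
have -> : [set: nat] = z @^-1` (x @` `I_n) by apply/seteqP; split=> // k _; exact: covered.
apply: finite_preimage; first by move=> p q _ _; exact: zinj.
by apply: finite_image; exact: finite_II.
Qed.

(** A point of [Omega] off the nodes has positive distance to them.  The
    supremum dominates this distance because the distances are bounded; without
    a bound [sup] would carry no information. *)
Lemma fill_distance_gt0 (Omega : set E) (x : nat -> E) n : (0 < d)%N ->
  bounded_domain Omega -> (0 < n)%N -> 0 < fill_distance Omega x n.
Proof.
move=> d0 [oO _ O0 [M [_ OM]]] n0.
have [z Oz zx] := open_not_covered x n d0 oO O0.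
pose dist w := inf [set norm2 (w - x i) | i in `I_n].
pose m := \big[Num.min/1]_(i < n) norm2 (z - x i).
have m0 : 0 < m.
  by apply/bigmin_gtP; split=> // i _; rewrite norm2_gt0 // subr_eq0 zx.
apply: (lt_le_trans m0); apply: (@le_trans _ _ (dist z)).
  apply: lb_le_inf; first by exists (norm2 (z - x 0)), 0.
  by move=> _ [i /= ilt <-]; exact: (bigmin_le _ (Ordinal ilt)).
apply: ub_le_sup; last by exists z.
(* [OM] bounds the norm by any number above [M], hence the [M + 1]. *)
exists (Num.sqrt ((M + 1 + `|x 0|) ^+ 2 *+ d)) => _ [w Ow <-].
apply: (@le_trans _ _ (norm2 (w - x 0))).
  apply: ge_inf; last by exists 0.
  by exists 0 => _ [i _ <-]; exact: sqrtr_ge0.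
apply: (le_trans (norm2_le_mx_norm _)); apply: ler_wsqrtr.
rewrite lerMn2r; apply/orP; right.
have wM : `|w - x 0| <= M + 1 + `|x 0|.
  by apply: (le_trans (ler_normB _ _)); rewrite lerD2r OM // ltrDl.
by rewrite ler_pXn2r ?nnegrE ?(le_trans _ wM).
Qed.

End FillDistance.

Theorem theorem3p2 (R : realType) (d : nat) (hd : (0 < d)%N)
  (Omega : set 'rV[R]_d) (hOmega : bounded_domain Omega)
  (L : nat) (hL : (1 <= L)%N)
  (N : nat -> nat) (x : nat -> 'rV[R]_d)
  (hN1 : (0 < N 1)%N)
  (hnested : forall l, (1 <= l < L)%N -> (N l <= N l.+1)%N)
  (hdistinct : forall i j, (i < N L)%N -> (j < N L)%N -> x i = x j -> i = j)
  (hx : forall i, (i < N L)%N -> Omega (x i))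
  (c mu : R) (hmu : 0 < mu < 1) (hc : 0 < c <= 1)
  (hfill : forall l, (1 <= l < L)%N ->
     c * mu * fill_distance Omega x (N l) <= fill_distance Omega x (N l.+1)
       <= mu * fill_distance Omega x (N l))
  (Phi : 'rV[R]_d -> R^o) (hPhi : posdef_rbf Phi)
  (hsupp : supported_in_unit_ball Phi)
  (nu : R) (hnu : 1 < nu) :
  let K l := rescale Phi (nu * fill_distance Omega x (N l)) in
  let V := multilevel_space K x N Omega L in
  let b := multilevel_cardinal (N := N) K x Omega (L := L) in
  [/\ is_basis V b,
      has_dimension V (N L)
    & forall i j : 'I_(N L), b i (x j) = (i == j)%:R].
Proof.
move=> K V b.
have mono k l : (1 <= k)%N -> (k <= l <= L)%N -> (N k <= N l)%N.
  move=> k1 /andP[]; elim: l => [|l IH]; first by rewrite leqNgt k1.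
  rewrite leq_eqVlt => /predU1P[-> //|]; rewrite ltnS => kl lL.
  apply: leq_trans (IH kl (ltnW lL)) (hnested _ _).
  by rewrite lL (leq_trans k1 kl).
have nested l : (1 <= l <= L)%N -> (N l <= N L)%N.
  by move=> /andP[l1 lL]; apply: mono => //; rewrite lL leqnn.
have unisolvent l : (1 <= l <= L)%N -> collocation (K l) x (N l) \in unitmx.
  move=> lL; apply: collocation_rescale_unit => //.
    apply/lt0r_neq0/mulr_gt0; first exact: lt_trans hnu.
    by apply: fill_distance_gt0 => //; apply: (leq_trans hN1); exact: mono.
  by move=> i j il jl; apply: hdistinct;
    [exact: leq_trans il (nested _ lL)|exact: leq_trans jl (nested _ lL)].
have Kcont : continuous (K L) by have [_ + _] := hPhi; exact: rescale_continuous.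
have bB : is_basis V b by exact: multilevel_cardinal_basis.
split=> //; first exact: basis_dimension bB.
exact: multilevel_cardinalP.
Qed.
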